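(* Let $\mathcal{C}$ be a triangulated category with translation functor $\Sigma$. (1) Suppose $\rho$ assigns to each morphism $f$ of $\mathcal{C}$ a real number $\rho(f)\geq0$ such that (M1) $\rho(\Sigma f)=\rho(f)$; (M2) $\rho(f\oplus g)=\rho(f)+\rho(g)$; (M3) for every exact triangle $X\xrightarrow{f}Y\xrightarrow{g}Z\rightsquigarrow$, $\rho(f)+\rho(g)=\rho(\mathrm{id}_Y)$. Then the function on objects $X\mapsto\rho(\mathrm{id}_X)$ is nonnegative and satisfies (O1) $\rho(\Sigma X)=\rho(X)$; (O2) $\rho(X\oplus Y)=\rho(X)+\rho(Y)$; (O3) for every exact triangle $X\to Y\to Z\rightsquigarrow$, $\rho(Y)\leq\rho(X)+\rho(Z)$. (2) Conversely, if $\rho$ assigns to each object a real number $\rho(X)\geq0$ satisfying (O1), (O2), (O3), then the assignment $\rho(f:X\to Y)=\frac{\rho(X)+\rho(Y)-\rho(\operatorname{cone}(f))}{2}$ is a nonnegative function on morphisms satisfying (M1), (M2), (M3). *)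

(* Defs.v *)
From HB Require Import structures.
From mathcomp Require Import all_boot all_algebra.
Set Implicit Arguments. Unset Strict Implicit. Unset Printing Implicit Defensive.
Import GRing.Theory Num.Theory.
Local Open Scope ring_scope.

Record AddShiftCat := {
  Obj : Type;
  Mor : Obj -> Obj -> zmodType;
  idm : forall X, Mor X X;
  comp : forall X Y Z, Mor Y Z -> Mor X Y -> Mor X Z;
  comp_assoc : forall X Y Z W (h : Mor Z W) (g : Mor Y Z) (f : Mor X Y),
      comp h (comp g f) = comp (comp h g) f;
  comp_idl : forall X Y (f : Mor X Y), comp (idm Y) f = f;
  comp_idr : forall X Y (f : Mor X Y), comp f (idm X) = f;
  comp_addl : forall X Y Z (g g' : Mor Y Z) (f : Mor X Y),
      comp (g + g') f = comp g f + comp g' f;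
  comp_addr : forall X Y Z (g : Mor Y Z) (f f' : Mor X Y),
      comp g (f + f') = comp g f + comp g f';
  zobj : Obj;
  zobj_id : idm zobj = 0;
  bsum : Obj -> Obj -> Obj;
  bin1 : forall X Y, Mor X (bsum X Y);
  bin2 : forall X Y, Mor Y (bsum X Y);
  bpr1 : forall X Y, Mor (bsum X Y) X;
  bpr2 : forall X Y, Mor (bsum X Y) Y;
  bpr1_in1 : forall X Y, comp (bpr1 X Y) (bin1 X Y) = idm X;
  bpr2_in2 : forall X Y, comp (bpr2 X Y) (bin2 X Y) = idm Y;
  bpr1_in2 : forall X Y, comp (bpr1 X Y) (bin2 X Y) = 0;
  bpr2_in1 : forall X Y, comp (bpr2 X Y) (bin1 X Y) = 0;
  bsum_id : forall X Y,
      comp (bin1 X Y) (bpr1 X Y) + comp (bin2 X Y) (bpr2 X Y) = idm (bsum X Y);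
  (* translation functor Sigma: additive, fully faithful, essentially surjective *)
  Sh : Obj -> Obj;
  ShH : forall X Y, Mor X Y -> Mor (Sh X) (Sh Y);
  ShH_id : forall X, ShH (idm X) = idm (Sh X);
  ShH_comp : forall X Y Z (g : Mor Y Z) (f : Mor X Y),
      ShH (comp g f) = comp (ShH g) (ShH f);
  ShH_add : forall X Y (f g : Mor X Y), ShH (f + g) = ShH f + ShH g;
  ShH_inj : forall X Y (f g : Mor X Y), ShH f = ShH g -> f = g;
  ShH_surj : forall X Y (g : Mor (Sh X) (Sh Y)), exists f : Mor X Y, ShH f = g;
  Sh_esurj : forall Y, exists X (u : Mor (Sh X) Y) (v : Mor Y (Sh X)),
      comp v u = idm (Sh X) /\ comp u v = idm Y
}.

Arguments idm {_} X.
Arguments comp {_ X Y Z}.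
Arguments zobj {_}.
Arguments bsum {_}.
Arguments bin1 {_ X Y}.
Arguments bin2 {_ X Y}.
Arguments bpr1 {_ X Y}.
Arguments bpr2 {_ X Y}.
Arguments Sh {_}.
Arguments ShH {_ X Y}.

Section Defs1.
Variable C : AddShiftCat.

Definition is_iso (X Y : Obj C) (a : Mor X Y) : Prop :=
  exists b : Mor Y X, comp b a = idm X /\ comp a b = idm Y.

Definition dsum_hom (X Y X' Y' : Obj C) (f : Mor X Y) (g : Mor X' Y')
  : Mor (bsum X X') (bsum Y Y') :=
  comp bin1 (comp f bpr1) + comp bin2 (comp g bpr2).

Definition tri_iso (X Y Z X' Y' Z' : Obj C)
  (f : Mor X Y) (g : Mor Y Z) (h : Mor Z (Sh X))
  (f' : Mor X' Y') (g' : Mor Y' Z') (h' : Mor Z' (Sh X')) : Prop :=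
  exists (a : Mor X X') (b : Mor Y Y') (c : Mor Z Z'),
    [/\ is_iso a, is_iso b & is_iso c] /\
    [/\ comp b f = comp f' a, comp c g = comp g' b
       & comp (ShH a) h = comp h' c].
End Defs1.

Arguments is_iso {_ X Y}.
Arguments dsum_hom {_ X Y X' Y'}.

(* Triangulated category: axioms TR1 (isomorphism closure, identity triangle,
   existence of cones -- here as a chosen cone), TR2 (rotation),
   TR3 (morphism completion) and TR4 (octahedral axiom). *)
Record TriCat := {
  base :> AddShiftCat;
  dist : forall (X Y Z : Obj base), Mor X Y -> Mor Y Z -> Mor Z (Sh X) -> Prop;
  dist_iso : forall (X Y Z X' Y' Z' : Obj base)
      (f : Mor X Y) (g : Mor Y Z) (h : Mor Z (Sh X))
      (f' : Mor X' Y') (g' : Mor Y' Z') (h' : Mor Z' (Sh X')),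
      tri_iso f g h f' g' h' -> dist f g h -> dist f' g' h';
  dist_idm : forall X : Obj base,
      dist (idm X) (0 : Mor X zobj) (0 : Mor zobj (Sh X));
  cone : forall (X Y : Obj base), Mor X Y -> Obj base;
  cone_in : forall (X Y : Obj base) (f : Mor X Y), Mor Y (cone f);
  cone_out : forall (X Y : Obj base) (f : Mor X Y), Mor (cone f) (Sh X);
  cone_dist : forall (X Y : Obj base) (f : Mor X Y), dist f (cone_in f) (cone_out f);
  dist_rot : forall (X Y Z : Obj base) (f : Mor X Y) (g : Mor Y Z) (h : Mor Z (Sh X)),
      dist f g h <-> dist g h (- ShH f);
  dist_complete : forall (X Y Z X' Y' Z' : Obj base)
      (f : Mor X Y) (g : Mor Y Z) (h : Mor Z (Sh X))
      (f' : Mor X' Y') (g' : Mor Y' Z') (h' : Mor Z' (Sh X'))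
      (a : Mor X X') (b : Mor Y Y'),
      dist f g h -> dist f' g' h' -> comp b f = comp f' a ->
      exists c : Mor Z Z', comp c g = comp g' b /\ comp (ShH a) h = comp h' c;
  octahedral : forall (X Y Z Z' X' Y' : Obj base) (f : Mor X Y) (g : Mor Y Z)
      (i1 : Mor Y Z') (d1 : Mor Z' (Sh X))
      (i2 : Mor Z X') (d2 : Mor X' (Sh Y))
      (i3 : Mor Z Y') (d3 : Mor Y' (Sh X)),
      dist f i1 d1 -> dist g i2 d2 -> dist (comp g f) i3 d3 ->
      exists (u : Mor Z' Y') (v : Mor Y' X'),
        [/\ dist u v (comp (ShH i1) d2),
            comp u i1 = comp i3 g, comp d3 u = d1,
            comp v i3 = i2 & comp d2 v = comp (ShH f) d3]
}.

Arguments dist {_ X Y Z}.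
Arguments cone {_ X Y}.

(* Main.v *)
Require Import Defs.
From HB Require Import structures.
From mathcomp Require Import all_boot all_algebra.
From mathcomp Require Import all_classical all_reals.
From mathcomp Require Import lra.
Import GRing.Theory Num.Theory.
Local Open Scope ring_scope.

Set Implicit Arguments. Unset Strict Implicit. Unset Printing Implicit Defensive.

(* For (1), (M3) applied to the
   cone triangle of [f] and to its second rotation gives [rho f <= rho(id_Y)] and
   [rho f <= rho(id_X)]; adding these for the first two maps of a triangle gives (O3).
   For (2), (O3) for [X ~= Y -> 0] shows that [rho] vanishes on [0] and is invariant
   under isomorphism, and the octahedral axiom for [f] followed by [id_Y] relates any
   two third vertices [Z], [Z'] over [f] by a triangle [Z -> Z' -> 0], so [rho] of
   the third vertex depends only on [f]; (M1) and (M3) then reduce to arithmetic.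
   (M2) rests on [cone (f (+) g) ~= cone f (+) cone g]: the comparison maps given by
   (TR3) compose to [1 + M] with [M] killing the incoming map and killed by the
   outgoing one, so [M] factors through the latter and [M^2 = 0]. *)

Local Notation comp := Defs.comp.
Local Notation bin1 := Defs.bin1.
Local Notation bin2 := Defs.bin2.

Section AdditiveCategory.
Variable C : AddShiftCat.
Implicit Types X Y Z V W : Obj C.

Lemma comp0l X Y Z (f : Mor X Y) : comp (0 : Mor Y Z) f = 0.
Proof.
have : comp (0 : Mor Y Z) f + comp 0 f = comp 0 f + 0 by rewrite -comp_addl !addr0.
exact: addrI.
Qed.

Lemma comp0r X Y Z (g : Mor Y Z) : comp g (0 : Mor X Y) = 0.
Proof.
have : comp g (0 : Mor X Y) + comp g 0 = comp g 0 + 0 by rewrite -comp_addr !addr0.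
exact: addrI.
Qed.

Lemma compNl X Y Z (g : Mor Y Z) (f : Mor X Y) : comp (- g) f = - comp g f.
Proof. by apply/eqP; rewrite -addr_eq0 -comp_addl addNr comp0l. Qed.

Lemma compNr X Y Z (g : Mor Y Z) (f : Mor X Y) : comp g (- f) = - comp g f.
Proof. by apply/eqP; rewrite -addr_eq0 -comp_addr addNr comp0r. Qed.

Lemma ShH0 X Y : ShH (0 : Mor X Y) = 0.
Proof.
have : ShH (0 : Mor X Y) + ShH 0 = ShH 0 + 0 by rewrite -ShH_add !addr0.
exact: addrI.
Qed.

Lemma idm_is_iso X : is_iso (idm X).
Proof. by exists (idm X); rewrite comp_idl. Qed.

Lemma is_iso_inv X Y (a : Mor X Y) : is_iso a -> exists b : Mor Y X, is_iso b.
Proof. by case=> b [ba ab]; exists b, a. Qed.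

Lemma is_iso_lr X Y (a : Mor X Y) (l r : Mor Y X) :
  comp l a = idm X -> comp a r = idm Y -> is_iso a.
Proof.
move=> la ar; exists r; split=> //.
have <- : l = r by rewrite -[r]comp_idl -la -comp_assoc ar comp_idr.
exact: la.
Qed.

(* [(1 + M) (1 - M) = 1] when [M^2 = 0]. *)
Lemma is_iso_unipotent X Y (a : Mor X Y) (b : Mor Y X) :
  comp (comp a b - idm Y) (comp a b - idm Y) = 0 ->
  comp (comp b a - idm X) (comp b a - idm X) = 0 -> is_iso a.
Proof.
set M := comp a b - idm Y; set N := comp b a - idm X => MM NN.
have ab : comp a b = idm Y + M by rewrite /M addrC subrK.
have ba : comp b a = idm X + N by rewrite /N addrC subrK.
apply: (@is_iso_lr _ _ _ (comp (idm X - N) b) (comp b (idm Y - M))).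
- rewrite -comp_assoc ba comp_addr !comp_addl !compNl !comp_idl comp_idr NN.
  by rewrite oppr0 addr0 subrK.
- rewrite comp_assoc ab comp_addl !comp_addr !compNr !comp_idr comp_idl MM.
  by rewrite oppr0 addr0 subrK.
Qed.

Lemma idm_bsum0 X Y : idm X = 0 -> idm Y = 0 -> idm (bsum X Y) = 0.
Proof.
move=> X0 Y0.
have pr1_0 : (bpr1 : Mor (bsum X Y) X) = 0 by rewrite -(comp_idl bpr1) X0 comp0l.
have pr2_0 : (bpr2 : Mor (bsum X Y) Y) = 0 by rewrite -(comp_idl bpr2) Y0 comp0l.
by rewrite -bsum_id pr1_0 pr2_0 !comp0r addr0.
Qed.

Lemma zero_is_iso X Y : idm X = 0 -> idm Y = 0 -> is_iso (0 : Mor X Y).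
Proof. by move=> X0 Y0; exists 0; rewrite !comp0r X0 Y0. Qed.

Definition bsum_copair X Y V (x : Mor X V) (y : Mor Y V) : Mor (bsum X Y) V :=
  comp x bpr1 + comp y bpr2.

Definition bsum_pair V X Y (x : Mor V X) (y : Mor V Y) : Mor V (bsum X Y) :=
  comp bin1 x + comp bin2 y.

Section Biproduct.
Variables X Y V : Obj C.

Lemma copair_in1 (x : Mor X V) (y : Mor Y V) : comp (bsum_copair x y) bin1 = x.
Proof. by rewrite comp_addl -!comp_assoc bpr1_in1 bpr2_in1 comp_idr comp0r addr0. Qed.

Lemma copair_in2 (x : Mor X V) (y : Mor Y V) : comp (bsum_copair x y) bin2 = y.
Proof. by rewrite comp_addl -!comp_assoc bpr1_in2 bpr2_in2 comp_idr comp0r add0r. Qed.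

Lemma pr1_pair (x : Mor V X) (y : Mor V Y) : comp bpr1 (bsum_pair x y) = x.
Proof. by rewrite comp_addr !comp_assoc bpr1_in1 bpr1_in2 comp_idl comp0l addr0. Qed.

Lemma pr2_pair (x : Mor V X) (y : Mor V Y) : comp bpr2 (bsum_pair x y) = y.
Proof. by rewrite comp_addr !comp_assoc bpr2_in1 bpr2_in2 comp_idl comp0l add0r. Qed.

Lemma copair_pair U (x : Mor X V) (y : Mor Y V) (a : Mor U X) (b : Mor U Y) :
  comp (bsum_copair x y) (bsum_pair a b) = comp x a + comp y b.
Proof. by rewrite {1}/bsum_pair comp_addr !comp_assoc copair_in1 copair_in2. Qed.

Lemma bsum_hom_extl (x y : Mor (bsum X Y) V) :
  comp x bin1 = comp y bin1 -> comp x bin2 = comp y bin2 -> x = y.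
Proof.
have eta (z : Mor (bsum X Y) V) : z = bsum_copair (comp z bin1) (comp z bin2).
  by rewrite /bsum_copair -!comp_assoc -comp_addr bsum_id comp_idr.
by move=> x1 x2; rewrite [x]eta [y]eta x1 x2.
Qed.

Lemma bsum_hom_extr (x y : Mor V (bsum X Y)) :
  comp bpr1 x = comp bpr1 y -> comp bpr2 x = comp bpr2 y -> x = y.
Proof.
have eta (z : Mor V (bsum X Y)) : z = bsum_pair (comp bpr1 z) (comp bpr2 z).
  by rewrite /bsum_pair !comp_assoc -comp_addl bsum_id comp_idl.
by move=> x1 x2; rewrite [x]eta [y]eta x1 x2.
Qed.

End Biproduct.

Section DirectSumOfMorphisms.
Variables (X Y X' Y' : Obj C) (f : Mor X Y) (g : Mor X' Y').

Lemma dsum_homE : dsum_hom f g = bsum_copair (comp bin1 f) (comp bin2 g).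
Proof. by rewrite /dsum_hom !comp_assoc. Qed.

Lemma dsum_hom_in1 : comp (dsum_hom f g) bin1 = comp bin1 f.
Proof. by rewrite dsum_homE copair_in1. Qed.

Lemma dsum_hom_in2 : comp (dsum_hom f g) bin2 = comp bin2 g.
Proof. by rewrite dsum_homE copair_in2. Qed.

Lemma pr1_dsum_hom : comp bpr1 (dsum_hom f g) = comp f bpr1.
Proof. exact: pr1_pair. Qed.

Lemma pr2_dsum_hom : comp bpr2 (dsum_hom f g) = comp g bpr2.
Proof. exact: pr2_pair. Qed.

End DirectSumOfMorphisms.

Lemma dsum_hom_idm X Y : dsum_hom (idm X) (idm Y) = idm (bsum X Y).
Proof. by rewrite /dsum_hom !comp_idl bsum_id. Qed.

Definition weak_cokernel Y Z W (g : Mor Y Z) (h : Mor Z W) : Prop :=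
  forall V (x : Mor Z V), comp x g = 0 -> exists k : Mor W V, x = comp k h.

Lemma weak_cokernel_sqr0 Y Z W (g : Mor Y Z) (h : Mor Z W) (M : Mor Z Z) :
  weak_cokernel g h -> comp M g = 0 -> comp h M = 0 -> comp M M = 0.
Proof.
move=> gh Mg hM; have [k Mk] := gh _ M Mg.
by rewrite {1}Mk -comp_assoc hM comp0r.
Qed.

Lemma weak_cokernel_iso Y Z Z' W (g : Mor Y Z) (h : Mor Z W)
    (g' : Mor Y Z') (h' : Mor Z' W) (a : Mor Z Z') (b : Mor Z' Z) :
  weak_cokernel g h -> weak_cokernel g' h' ->
  comp a g = g' -> comp h' a = h -> comp b g' = g -> comp h b = h' -> is_iso a.
Proof.
move=> gh gh' ag h'a bg' hb; apply: (is_iso_unipotent (b := b)).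
- apply: (weak_cokernel_sqr0 gh').
  + by rewrite comp_addl compNl -comp_assoc bg' ag comp_idl subrr.
  + by rewrite comp_addr compNr comp_assoc h'a hb comp_idr subrr.
- apply: (weak_cokernel_sqr0 gh).
  + by rewrite comp_addl compNl -comp_assoc ag bg' comp_idl subrr.
  + by rewrite comp_addr compNr comp_assoc hb h'a comp_idr subrr.
Qed.

Lemma weak_cokernel_dsum Y1 Z1 W1 Y2 Z2 W2 (g1 : Mor Y1 Z1) (h1 : Mor Z1 (Sh W1))
    (g2 : Mor Y2 Z2) (h2 : Mor Z2 (Sh W2)) :
  weak_cokernel g1 h1 -> weak_cokernel g2 h2 ->
  weak_cokernel (dsum_hom g1 g2) (bsum_copair (comp (ShH bin1) h1) (comp (ShH bin2) h2)).
Proof.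
move=> gh1 gh2 V x xg.
have [k1 xk1] : exists k1, comp x bin1 = comp k1 h1.
  by apply: gh1; rewrite -comp_assoc -(dsum_hom_in1 g1 g2) comp_assoc xg comp0l.
have [k2 xk2] : exists k2, comp x bin2 = comp k2 h2.
  by apply: gh2; rewrite -comp_assoc -(dsum_hom_in2 g1 g2) comp_assoc xg comp0l.
set k := comp k1 (ShH bpr1) + comp k2 (ShH bpr2).
have k_in1 : comp k (ShH bin1) = k1.
  by rewrite comp_addl -!comp_assoc -!ShH_comp bpr1_in1 bpr2_in1 ShH_id ShH0 comp_idr comp0r addr0.
have k_in2 : comp k (ShH bin2) = k2.
  by rewrite comp_addl -!comp_assoc -!ShH_comp bpr1_in2 bpr2_in2 ShH_id ShH0 comp_idr comp0r add0r.
exists k; apply: bsum_hom_extl.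
- by rewrite -comp_assoc copair_in1 comp_assoc k_in1.
- by rewrite -comp_assoc copair_in2 comp_assoc k_in2.
Qed.

End AdditiveCategory.

Section Triangulated.
Variable C : TriCat.
Implicit Types X Y Z V : Obj C.

Lemma dist_rotate X Y Z (f : Mor X Y) (g : Mor Y Z) (h : Mor Z (Sh X)) :
  dist f g h -> dist g h (- ShH f).
Proof. exact: (dist_rot f g h).1. Qed.

Lemma dist_opp X Y Z (f : Mor X Y) (g : Mor Y Z) (h : Mor Z (Sh X)) :
  dist f g h -> dist (- f) (- g) h.
Proof.
apply: dist_iso; exists (idm X), (- idm Y), (idm Z); split; split.
- exact: idm_is_iso.
- by exists (- idm Y); rewrite compNl compNr opprK comp_idl.
- exact: idm_is_iso.
- by rewrite compNl comp_idl comp_idr.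
- by rewrite compNr comp_idr comp_idl opprK.
- by rewrite ShH_id comp_idl comp_idr.
Qed.

Lemma dist_shift X Y Z (f : Mor X Y) (g : Mor Y Z) (h : Mor Z (Sh X)) :
  dist f g h -> dist (ShH f) (ShH g) (- ShH h).
Proof. by move=> /dist_rotate /dist_rotate /dist_rotate /dist_opp; rewrite !opprK. Qed.

Lemma dist_of_iso X Y (a : Mor X Y) :
  is_iso a -> dist a (0 : Mor Y zobj) (0 : Mor zobj (Sh X)).
Proof.
move=> a_iso; apply: dist_iso (dist_idm X).
exists (idm X), a, (idm zobj); split; split=> //; try exact: idm_is_iso.
- by rewrite comp0l comp0r.
- by rewrite comp0l comp0r.
Qed.

Lemma dist_zero_idm V : dist (0 : Mor zobj V) (idm V) (0 : Mor V (Sh zobj)).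
Proof.
have [X [u [v [vu uv]]]] := Sh_esurj V.
have := dist_rotate (dist_rotate (dist_idm X)).
rewrite ShH0 oppr0 ShH_id; apply: dist_iso.
exists (idm zobj), u, (- u); split; split.
- exact: idm_is_iso.
- by exists v.
- by exists (- v); rewrite !compNl !compNr !opprK.
- by rewrite comp0r comp0l.
- by rewrite compNl compNr opprK comp_idr comp_idl.
- by rewrite !comp0r comp0l.
Qed.

(* Morphism completion (TR3) against the triangle [0 -> V -> V]. *)
Lemma dist_weak_cokernel X Y Z (f : Mor X Y) (g : Mor Y Z) (h : Mor Z (Sh X)) :
  dist f g h -> weak_cokernel f g.
Proof.
move=> T V x xf.
have x0 : comp x f = comp (0 : Mor zobj V) (0 : Mor X zobj) by rewrite comp0l.
have [k [kg _]] := dist_complete T (dist_zero_idm V) x0.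
by exists k; rewrite kg comp_idl.
Qed.

(* The octahedral axiom applied to [f] followed by [idm Y]. *)
Lemma dist_third_vertex_cmp X Y Z Z' (f : Mor X Y) (g : Mor Y Z) (h : Mor Z (Sh X))
    (g' : Mor Y Z') (h' : Mor Z' (Sh X)) :
  dist f g h -> dist f g' h' ->
  exists (u : Mor Z Z') (v : Mor Z' zobj) (w : Mor zobj (Sh Z)), dist u v w.
Proof.
move=> T T'; rewrite -[f]comp_idl in T'.
have [u [v [uv _ _ _ _]]] := octahedral T (dist_idm Y) T'.
by exists u, v, (comp (ShH g) 0).
Qed.

Lemma cone_dsum_iso X Y X' Y' (f : Mor X Y) (g : Mor X' Y') :
  exists a : Mor (bsum (cone f) (cone g)) (cone (dsum_hom f g)), is_iso a.
Proof.
set F := dsum_hom f g.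
have Tf := cone_dist f; have Tg := cone_dist g; have TF := cone_dist F.
have [c1 [c1_in c1_out]] := dist_complete Tf TF (esym (dsum_hom_in1 f g)).
have [c2 [c2_in c2_out]] := dist_complete Tg TF (esym (dsum_hom_in2 f g)).
have [d1 [d1_in d1_out]] := dist_complete TF Tf (pr1_dsum_hom f g).
have [d2 [d2_in d2_out]] := dist_complete TF Tg (pr2_dsum_hom f g).
exists (bsum_copair c1 c2).
have wc_sum := weak_cokernel_dsum (dist_weak_cokernel (dist_rotate Tf))
                                  (dist_weak_cokernel (dist_rotate Tg)).
apply: (weak_cokernel_iso (b := bsum_pair d1 d2) wc_sum
                          (dist_weak_cokernel (dist_rotate TF))).
- apply: bsum_hom_extl.
  + by rewrite -!comp_assoc dsum_hom_in1 comp_assoc copair_in1 c1_in.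
  + by rewrite -!comp_assoc dsum_hom_in2 comp_assoc copair_in2 c2_in.
- apply: bsum_hom_extl.
  + by rewrite -!comp_assoc !copair_in1 c1_out.
  + by rewrite -!comp_assoc !copair_in2 c2_out.
- apply: bsum_hom_extr.
  + by rewrite comp_assoc pr1_pair pr1_dsum_hom d1_in.
  + by rewrite comp_assoc pr2_pair pr2_dsum_hom d2_in.
- rewrite copair_pair -!comp_assoc -d1_out -d2_out !comp_assoc -!ShH_comp.
  by rewrite -comp_addl -ShH_add bsum_id ShH_id comp_idl.
Qed.

End Triangulated.

Section MorphismToObject.
Variables (C : TriCat) (R : realDomainType) (rho : forall X Y : Obj C, Mor X Y -> R).
Hypothesis rho_ge0 : forall X Y (f : Mor X Y), 0 <= rho f.
Hypothesis rho_shift : forall X Y (f : Mor X Y), rho (ShH f) = rho f.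
Hypothesis rho_dsum : forall X Y X' Y' (f : Mor X Y) (g : Mor X' Y'),
  rho (dsum_hom f g) = rho f + rho g.
Hypothesis rho_dist : forall X Y Z (f : Mor X Y) (g : Mor Y Z) (h : Mor Z (Sh X)),
  dist f g h -> rho f + rho g = rho (idm Y).

Lemma rho_idm_shift X : rho (idm (Sh X)) = rho (idm X).
Proof. by rewrite -ShH_id rho_shift. Qed.

Lemma rho_idm_bsum X Y :
  rho (idm (bsum X Y)) = rho (idm X) + rho (idm Y).
Proof. by rewrite -dsum_hom_idm rho_dsum. Qed.

Lemma rho_le_idm_src X Y (f : Mor X Y) : rho f <= rho (idm X).
Proof.
have := rho_dist (dist_opp (dist_rotate (dist_rotate (cone_dist f)))).
rewrite opprK rho_shift rho_idm_shift => <-.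
exact: ler_wpDl.
Qed.

Lemma rho_le_idm_tgt X Y (f : Mor X Y) : rho f <= rho (idm Y).
Proof. by rewrite -(rho_dist (cone_dist f)) lerDl. Qed.

Lemma rho_idm_dist_le X Y Z (f : Mor X Y) (g : Mor Y Z) (h : Mor Z (Sh X)) :
  dist f g h -> rho (idm Y) <= rho (idm X) + rho (idm Z).
Proof. by move=> T; rewrite -(rho_dist T) lerD ?rho_le_idm_src ?rho_le_idm_tgt. Qed.

End MorphismToObject.

Section ObjectToMorphism.
Variables (C : TriCat) (R : realFieldType) (rhoO : Obj C -> R).
Hypothesis rhoO_ge0 : forall X, 0 <= rhoO X.
Hypothesis rhoO_shift : forall X, rhoO (Sh X) = rhoO X.
Hypothesis rhoO_bsum : forall X Y, rhoO (bsum X Y) = rhoO X + rhoO Y.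
Hypothesis rhoO_dist_le : forall X Y Z (f : Mor X Y) (g : Mor Y Z) (h : Mor Z (Sh X)),
  dist f g h -> rhoO Y <= rhoO X + rhoO Z.

(* [0 ~= 0 (+) 0 (+) 0] gives [3 rhoO 0 <= 2 rhoO 0]. *)
Lemma rhoO_zobj : rhoO zobj = 0.
Proof.
have W0 := idm_bsum0 (idm_bsum0 (zobj_id C) (zobj_id C)) (zobj_id C).
have := rhoO_dist_le (dist_of_iso (zero_is_iso (zobj_id C) W0)).
by rewrite !rhoO_bsum; have := rhoO_ge0 zobj; lra.
Qed.

Lemma rhoO_iso X Y (a : Mor X Y) : is_iso a -> rhoO X = rhoO Y.
Proof.
move=> a_iso; have [b b_iso] := is_iso_inv a_iso.
have := rhoO_dist_le (dist_of_iso a_iso); have := rhoO_dist_le (dist_of_iso b_iso).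
by rewrite rhoO_zobj; lra.
Qed.

Lemma rhoO_third_vertex X Y Z Z' (f : Mor X Y) (g : Mor Y Z) (h : Mor Z (Sh X))
    (g' : Mor Y Z') (h' : Mor Z' (Sh X)) :
  dist f g h -> dist f g' h' -> rhoO Z = rhoO Z'.
Proof.
move=> T T'.
have [u [v [w D]]] := dist_third_vertex_cmp T T'.
have [u' [v' [w' D']]] := dist_third_vertex_cmp T' T.
have := rhoO_dist_le D; have := rhoO_dist_le D'.
by rewrite rhoO_zobj; lra.
Qed.

Lemma rhoO_cone X Y Z (f : Mor X Y) (g : Mor Y Z) (h : Mor Z (Sh X)) :
  dist f g h -> rhoO (cone f) = rhoO Z.
Proof. exact: rhoO_third_vertex (cone_dist f). Qed.

Definition mor_rho X Y (f : Mor X Y) : R := (rhoO X + rhoO Y - rhoO (cone f)) / 2.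

Lemma mor_rho_ge0 X Y (f : Mor X Y) : 0 <= mor_rho f.
Proof.
have := rhoO_dist_le (dist_rotate (cone_dist f)).
by rewrite rhoO_shift /mor_rho => ?; apply: divr_ge0; lra.
Qed.

Lemma mor_rho_shift X Y (f : Mor X Y) : mor_rho (ShH f) = mor_rho f.
Proof. by rewrite /mor_rho (rhoO_cone (dist_shift (cone_dist f))) !rhoO_shift. Qed.

Lemma mor_rho_dsum X Y X' Y' (f : Mor X Y) (g : Mor X' Y') :
  mor_rho (dsum_hom f g) = mor_rho f + mor_rho g.
Proof.
have [a a_iso] := cone_dsum_iso f g.
by rewrite /mor_rho -(rhoO_iso a_iso) !rhoO_bsum; lra.
Qed.

Lemma mor_rho_dist X Y Z (f : Mor X Y) (g : Mor Y Z) (h : Mor Z (Sh X)) :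
  dist f g h -> mor_rho f + mor_rho g = mor_rho (idm Y).
Proof.
move=> T; rewrite /mor_rho (rhoO_cone T) (rhoO_cone (dist_rotate T)).
by rewrite (rhoO_cone (dist_idm Y)) rhoO_zobj rhoO_shift; lra.
Qed.

End ObjectToMorphism.

Theorem proposition2p4 (C : TriCat) (R : realType) :
  (* (1) morphism function -> object function *)
  (forall rho : forall X Y : Obj C, Mor X Y -> R,
     (forall (X Y : Obj C) (f : Mor X Y), 0 <= rho X Y f) ->
     (forall (X Y : Obj C) (f : Mor X Y), rho _ _ (ShH f) = rho X Y f) ->
     (forall (X Y X' Y' : Obj C) (f : Mor X Y) (g : Mor X' Y'),
        rho _ _ (dsum_hom f g) = rho X Y f + rho X' Y' g) ->
     (forall (X Y Z : Obj C) (f : Mor X Y) (g : Mor Y Z) (h : Mor Z (Sh X)),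
        dist f g h -> rho X Y f + rho Y Z g = rho Y Y (idm Y)) ->
     let rhoO := fun X : Obj C => rho X X (idm X) in
     [/\ (forall X : Obj C, 0 <= rhoO X),
         (forall X : Obj C, rhoO (Sh X) = rhoO X),
         (forall X Y : Obj C, rhoO (bsum X Y) = rhoO X + rhoO Y)
       & (forall (X Y Z : Obj C) (f : Mor X Y) (g : Mor Y Z) (h : Mor Z (Sh X)),
            dist f g h -> rhoO Y <= rhoO X + rhoO Z)]) /\
  (* (2) object function -> morphism function *)
  (forall rhoO : Obj C -> R,
     (forall X : Obj C, 0 <= rhoO X) ->
     (forall X : Obj C, rhoO (Sh X) = rhoO X) ->
     (forall X Y : Obj C, rhoO (bsum X Y) = rhoO X + rhoO Y) ->
     (forall (X Y Z : Obj C) (f : Mor X Y) (g : Mor Y Z) (h : Mor Z (Sh X)),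
        dist f g h -> rhoO Y <= rhoO X + rhoO Z) ->
     let rho := fun (X Y : Obj C) (f : Mor X Y) =>
                  (rhoO X + rhoO Y - rhoO (cone f)) / 2 in
     [/\ (forall (X Y : Obj C) (f : Mor X Y), 0 <= rho X Y f),
         (forall (X Y : Obj C) (f : Mor X Y), rho _ _ (ShH f) = rho X Y f),
         (forall (X Y X' Y' : Obj C) (f : Mor X Y) (g : Mor X' Y'),
            rho _ _ (dsum_hom f g) = rho X Y f + rho X' Y' g)
       & (forall (X Y Z : Obj C) (f : Mor X Y) (g : Mor Y Z) (h : Mor Z (Sh X)),
            dist f g h -> rho X Y f + rho Y Z g = rho Y Y (idm Y))]).
Proof.
split=> [rho rho_ge0 rho_shift rho_dsum rho_dist rhoO
        | rhoO rhoO_ge0 rhoO_shift rhoO_bsum rhoO_dist_le rho].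
- split=> [X | X | X Y | X Y Z f g h].
  + exact: rho_ge0.
  + exact: rho_idm_shift.
  + exact: rho_idm_bsum.
  + exact: rho_idm_dist_le.
- split=> [X Y f | X Y f | X Y X' Y' f g | X Y Z f g h].
  + exact: mor_rho_ge0.
  + exact: mor_rho_shift.
  + exact: mor_rho_dsum.
  + exact: mor_rho_dist.
Qed.
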